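(* Let $\mathcal{A}\in\mathbb{R}^{m\times l\times n}$ have all row slices $\mathcal{A}_{i::}$ nonzero, let $\mathcal{B}\in\mathbb{R}^{m\times p\times n}$, and let $I_\le,I_=$ be disjoint sets partitioning $\{1,\dots,m\}$. Suppose that the system $$\mathcal{A}_{i::}*\mathcal{X}\le\mathcal{B}_{i::}\ (i\in I_\le),\qquad \mathcal{A}_{i::}*\mathcal{X}=\mathcal{B}_{i::}\ (i\in I_=)$$ in the unknown $\mathcal{X}\in\mathbb{R}^{l\times p\times n}$ has a nonempty feasible region $\Omega$. Let step sizes $t_i$ satisfy $0<t_i<2\|\mathcal{A}_{i::}\|_F^2/\max_{1\le j\le n}\|F(\mathcal{A}_{i::})_j\|_F^2$ for $i=1,\dots,m$. Then for any initial $\mathcal{X}^0\in\mathbb{R}^{l\times p\times n}$ the sequence of iterates $\{\mathcal{X}^k\}_{k\ge0}$ generated by the TRK-L algorithm (described in the context) converges linearly in expectation: for each $k\ge 0$, $$\mathbb{E}\left[d(\mathcal{X}^{k+1},\Omega)^2\,\middle|\,\mathcal{X}^k\right]\le\left(1-\min_{1\le i\le m}2t_i\left(1-\frac{t_i\max_{1\le j\le n}\|F(\mathcal{A}_{i::})_j\|_F^2}{2\|\mathcal{A}_{i::}\|_F^2}\right)\frac{1}{\gamma^2\|\mathcal{A}\|_F^2}\right)d(\mathcal{X}^k,\Omega)^2,$$ where $\gamma>0$ is the smallest constant such that $d(\mathcal{X},\Omega)\le\gamma\,\|c_T(\mathcal{A}*\mathcal{X}-\mathcal{B})\|_F$ for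 all $\mathcal{X}\in\mathbb{R}^{l\times p\times n}$.
   Context: For $\mathcal{A}\in\mathbb{R}^{m\times l\times n}$, $A_k=\mathcal{A}(:,:,k)$ is the $k$-th frontal slice and $\mathcal{A}_{i::}=\mathcal{A}(i,:,:)\in\mathbb{R}^{1\times l\times n}$ the $i$-th row slice. $\mathrm{unfold}(\mathcal{A})\in\mathbb{R}^{mn\times l}$ stacks $A_1,\dots,A_n$ vertically, and $\mathrm{fold}$ is its inverse. $\mathrm{bcirc}(\mathcal{A})\in\mathbb{R}^{mn\times ln}$ is the block circulant matrix whose $(r,s)$ block is $A_{((r-s)\bmod n)+1}$ (first block column $A_1,\dots,A_n$). The t-product of $\mathcal{A}\in\mathbb{R}^{m\times l\times n}$ and $\mathcal{X}\in\mathbb{R}^{l\times p\times n}$ is $\mathcal{A}*\mathcal{X}=\mathrm{fold}(\mathrm{bcirc}(\mathcal{A})\,\mathrm{unfold}(\mathcal{X}))\in\mathbb{R}^{m\times p\times n}$. The transpose $\mathcal{A}^T\in\mathbb{R}^{l\times m\times n}$ is obtained by transposing each frontal slice and then reversing the order of the transposed frontal slices $2$ through $n$. $\|\mathcal{A}\|_F=\big(\sum_{i,j,k}\mathcal{A}(i,j,k)^2\big)^{1/2}$ (with absolute values for complex arrays, and likewise for matrices), and $d(\mathcal{X},\Omega)=\min_{\mathcal{Y}\in\Omega}\|\mathcal{X}-\mathcal{Y}\|_F$. Inequalities between tensors are entrywise, and $(\mathcal{M})_+$ is the entrywise maximum of $\mathcal{M}$ and $0$. The DFT of $\mathcal{A}$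 is the complex tensor $F(\mathcal{A})$ of the same size with $F(\mathcal{A})(i,j,:)=\sqrt{n}\,F_n\,\mathcal{A}(i,j,:)$, where $F_n$ is the $n\times n$ unitary DFT matrix; $F(\mathcal{A})_k=F(\mathcal{A})(:,:,k)$ is its $k$-th frontal slice. The function $c_T:\mathbb{R}^{m\times p\times n}\to\mathbb{R}^{m\times p\times n}$ is $c_T(\mathcal{Z})(i,j,k)=\max\{\mathcal{Z}(i,j,k),0\}$ if $i\in I_\le$ and $c_T(\mathcal{Z})(i,j,k)=\mathcal{Z}(i,j,k)$ if $i\in I_=$. TRK-L algorithm: given $\mathcal{X}^0$, at each iteration $k=0,1,2,\dots$ sample (independently of the past) an index $i_k\in\{1,\dots,m\}$ with probabilities $p_i=\|\mathcal{A}_{i::}\|_F^2/\|\mathcal{A}\|_F^2$, and set $$\mathcal{X}^{k+1}=\mathcal{X}^k-t_{i_k}\frac{\mathcal{A}_{i_k::}^T*(\mathcal{A}_{i_k::}*\mathcal{X}^k-\mathcal{B}_{i_k::})_+}{\|\mathcal{A}_{i_k::}\|_F^2}\ \text{ if } i_k\in I_\le,$$ $$\mathcal{X}^{k+1}=\mathcal{X}^k-t_{i_k}\frac{\mathcal{A}_{i_k::}^T*(\mathcal{A}_{i_k::}*\mathcal{X}^k-\mathcal{B}_{i_k::})}{\|\mathcal{A}_{i_k::}\|_F^2}\ \text{ if } i_k\in I_=.$$ *)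

(* Defs.v *)
From HB Require Import structures.
From mathcomp Require Import all_boot all_order all_algebra.
From mathcomp Require Import complex.
From mathcomp Require Import all_classical all_reals all_analysis.

Set Implicit Arguments.
Unset Strict Implicit.
Unset Printing Implicit Defensive.

Import Order.TTheory GRing.Theory Num.Theory.

Local Open Scope classical_set_scope.
Local Open Scope ring_scope.

(* A tensor in R^(m x l x n) is the family of its n frontal slices:
   [A k i j] is A(i, j, k), all indices starting at 0. *)
Notation tensor R m l n := {ffun 'I_n -> 'M[R]_(m, l)}.

(* The number of frontal slices is written n.+1, so that 'I_n.+1 is the
   additive group Z/(n+1) and [r - s], [- k] on slice indices are taken
   modulo the number of slices. *)

Definition unfold (R : Type) (m l n : nat) (A : tensor R m l n.+1) :
    'M[R]_(\sum_(k < n.+1) m, l) :=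
  \mxcol_(k < n.+1) A k.

Definition fold (R : Type) (m l n : nat)
    (M : 'M[R]_(\sum_(k < n.+1) m, l)) : tensor R m l n.+1 :=
  [ffun k : 'I_n.+1 => submxcol M k].

Definition bcirc (R : Type) (m l n : nat) (A : tensor R m l n.+1) :
    'M[R]_(\sum_(r < n.+1) m, \sum_(s < n.+1) l) :=
  \mxblock_(r < n.+1, s < n.+1) A (r - s).

Definition tprod (R : pzRingType) (m l p n : nat)
    (A : tensor R m l n.+1) (X : tensor R l p n.+1) : tensor R m p n.+1 :=
  fold (bcirc A *m unfold X).

(* [- k] fixes slice 0 and reverses the order of the remaining ones. *)
Definition ttr (R : Type) (m l n : nat) (A : tensor R m l n.+1) :
    tensor R l m n.+1 :=
  [ffun k : 'I_n.+1 => (A (- k))^T].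

Definition row_slice (R : Type) (m l n : nat) (i : 'I_m)
    (A : tensor R m l n) : tensor R 1 l n :=
  [ffun k : 'I_n => row i (A k)].

Definition tle (R : numDomainType) (m l n : nat) (A B : tensor R m l n) : Prop :=
  forall k i j, A k i j <= B k i j.

Definition tpos (R : realDomainType) (m l n : nat) (A : tensor R m l n) :
    tensor R m l n :=
  [ffun k : 'I_n => \matrix_(i, j) Num.max (A k i j) 0].

Definition fnorm (R : rcfType) (m l n : nat) (A : tensor R m l n) : R :=
  Num.sqrt (\sum_i \sum_j \sum_k A k i j ^+ 2).

Definition fnormC (R : rcfType) (m l : nat) (M : 'M[R[i]]_(m, l)) : R :=
  Num.sqrt (\sum_i \sum_j (ComplexField.Normc.normc (M i j)) ^+ 2).

(* exp(- 2 pi i / n) *)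
Definition dft_root (R : realType) (n : nat) : R[i] :=
  Complex (cos (2 * pi / n%:R)) (- sin (2 * pi / n%:R)).

Definition dft_mx (R : realType) (n : nat) : 'M[R[i]]_n :=
  \matrix_(r, s) (real_complex R (Num.sqrt n%:R)^-1 * dft_root R n ^+ (r * s)).

Definition dft (R : realType) (m l n : nat) (A : tensor R m l n) :
    tensor R[i] m l n :=
  [ffun k : 'I_n => \matrix_(i, j)
    (real_complex R (Num.sqrt n%:R) *
     \sum_s dft_mx R n k s * real_complex R (A s i j))].

(* The infimum is attained when Omega is closed and nonempty, as feasible
   regions below are. *)
Definition tdist (R : realType) (m l n : nat) (X : tensor R m l n)
    (Omega : set (tensor R m l n)) : R :=
  inf [set fnorm (X - Y) | Y in Omega].

Definition feasible (R : realType) (m l p n : nat)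
    (A : tensor R m l n.+1) (B : tensor R m p n.+1) (Ile Ieq : {set 'I_m}) :
    set (tensor R l p n.+1) :=
  [set X | (forall i, i \in Ile ->
              tle (tprod (row_slice i A) X) (row_slice i B)) /\
           (forall i, i \in Ieq ->
              tprod (row_slice i A) X = row_slice i B)].

(* Row indices outside Ile are those of equality constraints. *)
Definition cT (R : realDomainType) (m p n : nat) (Ile : {set 'I_m})
    (Z : tensor R m p n) : tensor R m p n :=
  [ffun k : 'I_n => \matrix_(i, j)
    if i \in Ile then Num.max (Z k i j) 0 else Z k i j].

Definition hoffman_bounds (R : realType) (m l p n : nat)
    (A : tensor R m l n.+1) (B : tensor R m p n.+1) (Ile Ieq : {set 'I_m}) :
    set R :=
  [set g | forall X : tensor R l p n.+1,
     tdist X (feasible A B Ile Ieq) <= g * fnorm (cT Ile (tprod A X - B))].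

Definition least (R : realType) (S : set R) (g : R) : Prop := S g /\ lbound S g.

Definition trkl_step (R : realType) (m l p n : nat)
    (A : tensor R m l n.+1) (B : tensor R m p n.+1) (Ile : {set 'I_m})
    (t : 'I_m -> R) (i : 'I_m) (X : tensor R l p n.+1) : tensor R l p n.+1 :=
  let Ai := row_slice i A in
  let res := tprod Ai X - row_slice i B in
  X - (t i / fnorm Ai ^+ 2) *:
      tprod (ttr Ai) (if i \in Ile then tpos res else res).

Fixpoint trkl (R : realType) (m l p n : nat)
    (A : tensor R m l n.+1) (B : tensor R m p n.+1) (Ile : {set 'I_m})
    (t : 'I_m -> R) (X0 : tensor R l p n.+1) (T : Type) (idx : nat -> T -> 'I_m)
    (k : nat) (w : T) : tensor R l p n.+1 :=
  if k is k'.+1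
  then trkl_step A B Ile t (idx k' w) (trkl A B Ile t X0 idx k' w)
  else X0.

Definition past_events (T : Type) (m : nat) (idx : nat -> T -> 'I_m) (k : nat) :
    set (set T) :=
  <<s [set E | exists j i, (j < k)%N /\ E = idx j @^-1` [set i]] >>.

Definition sampling (R : realType) (m : nat) (q : 'I_m -> R)
    (d : measure_display) (T : measurableType d) (P : probability T R)
    (idx : nat -> T -> 'I_m) : Prop :=
  [/\ forall k i, measurable (idx k @^-1` [set i]),
      forall k i, P (idx k @^-1` [set i]) = (q i)%:E &
      forall k i H, past_events idx k H ->
        P (H `&` (idx k @^-1` [set i])) = (P H * P (idx k @^-1` [set i]))%E].

(* The sigma-algebra sigma(X) of a random tensor X. *)
Definition sigma_tensor (R : realType) (T : Type) (m l n : nat)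
    (X : T -> tensor R m l n) : set (set T) :=
  <<s [set E | exists k i j (S : set R),
         measurable S /\ E = (fun w => X w k i j) @^-1` S] >>.

(* [g] is a version of the conditional expectation E[f | G]. *)
Definition is_condexp (R : realType) (d : measure_display)
    (T : measurableType d) (P : probability T R) (G : set (set T))
    (f g : T -> R) : Prop :=
  [/\ P.-integrable setT (EFin \o f),
      P.-integrable setT (EFin \o g),
      forall S : set R, measurable S -> G (g @^-1` S) &
      forall E, G E -> (\int[P]_(w in E) (g w)%:E = \int[P]_(w in E) (f w)%:E)%E].

Definition max_slice_norm2 (R : realType) (m l n : nat) (A : tensor R m l n) : R :=
  \big[Num.max/0]_(j < n) fnormC (dft A j) ^+ 2.

Definition min_ord (R : realDomainType) (m : nat) (f : 'I_m.+1 -> R) : R :=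
  \big[Num.min/f ord0]_(i < m.+1) f i.

Definition trkl_rate (R : realType) (m l n : nat)
    (A : tensor R m.+1 l n) (t : 'I_m.+1 -> R) (gamma : R) : R :=
  1 - min_ord (fun i =>
        2 * t i * (1 - t i * max_slice_norm2 (row_slice i A) /
                       (2 * fnorm (row_slice i A) ^+ 2)))
      * (1 / (gamma ^+ 2 * fnorm A ^+ 2)).

(* Main.v *)
Require Import Defs.
From mathcomp Require Import all_boot all_order all_algebra.
From mathcomp Require Import complex.
From mathcomp Require Import all_classical all_reals all_analysis.
From mathcomp Require Import ring lra.
Import Order.TTheory GRing.Theory Num.Theory.
Local Open Scope classical_set_scope.
Local Open Scope ring_scope.

Set Implicit Arguments.
Unset Strict Implicit.
Unset Printing Implicit Defensive.

(** The squared distance to the feasible region decreases at every step.  Let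
    [r] be the row of the residual that is sampled (positive part for an
    inequality) and [Y] any feasible tensor.  Since the transpose is the
    adjoint of the t-product, moving along [- A_i^T * r] has inner product at
    least [|r|^2] with the direction from the iterate towards [Y], and the
    discrete Fourier transform, which diagonalises the convolution, bounds
    [|A_i^T * r|^2] by the largest [|F(A_i)_j|^2] times [|r|^2].  Hence
    [|X' - Y|^2 <= |X - Y|^2 - c_i |r|^2] with [c_i > 0] in the admissible
    range of step sizes ([step_to_feasible]).  Taking the infimum over [Y]
    transfers this to the distance ([tdist_step]).  Averaged with the sampling
    weights the rows add up to the full residual, which the Hoffman bound
    compares with the distance ([expected_step]).

    A Hoffman constant exists by quantitative Fourier-Motzkin elimination
    ([small_solution]): a solvable system of linear inequalities that the
    origin violates by at most [e] has a solution of size O(e), with a constant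
    that depends on the coefficients only.  Translating to a point [X] bounds
    the distance of [X] to the feasible region by its residual.  The constants
    form a set closed under infima and are positive, because some point is
    infeasible ([least_hoffman_bound], [hoffman_bounds_gt0]).

    For the probabilistic statement, the [k]-th iterate is a function of the
    finite history of sampled indices, so that conditioning is summation over
    finitely many atoms.  The average over a fresh index of the next squared
    distance, evaluated at the current iterate, is a version of the conditional
    expectation ([is_condexp_step]), and every version agrees with it almost
    surely because it is constant on the fibres of the iterate
    ([condexp_step_unique]). *)

(** * A quantitative Fourier-Motzkin elimination *)

(** A finite family of lower bounds, each below every upper bound, leaves room
    for a point, and the largest lower bound is one. Clipping it from below at
    [- D] keeps it in [[- D, D]] and below the upper bounds: this is what
    controls the size of the eliminated variable in [small_solution_ord]. *)
Lemma exists_between (R : realFieldType) (I : finType) (PL PU : pred I)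
    (L U : I -> R) (D : R) :
  0 <= D -> (forall i, PL i -> L i <= D) -> (forall j, PU j -> - D <= U j) ->
  (forall i j, PL i -> PU j -> L i <= U j) ->
  exists z, [/\ forall i, PL i -> L i <= z, forall j, PU j -> z <= U j
              & `|z| <= D].
Proof.
move=> D0 LD DU LU; exists (\big[Num.max/- D]_(i | PL i) L i); split.
- by move=> i Pi; exact: (le_bigmax_cond _ _ Pi).
- move=> j Pj; apply/bigmax_leP; split; first exact: DU.
  by move=> i Pi; exact: LU.
- rewrite ler_norml bigmax_ge_id /=.
  by apply/bigmax_leP; split; [lra|exact: LD].
Qed.

(** Hoffman's lemma, after translation of the point to the origin: [- e <= b]
    says that the origin violates no inequality by more than [e], and the
    conclusion gives a solution at distance O(e) from it. The proof is
    Fourier-Motzkin elimination of the first variable with sizes tracked.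
    Adding an inequality that bounds the variable from above to one that
    bounds it from below gives a system in the other variables whose right-
    hand side is still at least [- (2 * S + 1) * e]; induction gives a small
    solution of it, and then all upper bounds for the first variable are at
    least a multiple of [- e], all lower ones at most that multiple of [e].
    The constant depends on the matrix only, never on [b]; this uniformity is
    the point, since [b] varies with the translated point. *)
Lemma small_solution_ord (R : realFieldType) (N : nat) (I : finType)
    (a : I -> 'I_N -> R) :
  exists2 C, 0 <= C & forall (b : I -> R) (e : R), 0 <= e ->
    (forall i, - e <= b i) ->
    (exists y : 'I_N -> R, forall i, \sum_j a i j * y j <= b i) ->
    exists2 y : 'I_N -> R, forall i, \sum_j a i j * y j <= b i
                         & forall j, `|y j| <= C * e.
Proof.
elim: N I a => [|N IH] I a.
  exists 0 => // b e e0 be [y yb]; exists y => //; by case.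
pose a0 i := a i ord0.
(* The eliminated system is indexed by all pairs: a pair that does not combine
   two inequalities of opposite signs carries the trivial [0 <= 0] or, when
   the variable does not occur in its first inequality, that inequality. *)
pose comb (c : I -> R) (q : I * I) : R :=
  if (0 < a0 q.1) && (a0 q.2 < 0) then - a0 q.2 * c q.1 + a0 q.1 * c q.2
  else if a0 q.1 == 0 then c q.1 else 0.
have comb_sum (c : 'I_N -> I -> R) (y : 'I_N -> R) q :
    \sum_j comb (c j) q * y j = comb (fun i => \sum_j c j i * y j) q.
  rewrite /comb; case: ifP => _; last case: ifP => _ //.
  - rewrite !mulr_sumr -big_split; apply: eq_bigr => j _ /=; ring.
  - by rewrite big1 // => j _; rewrite mul0r.
have comb_le (c c' : I -> R) q : (forall i, c i <= c' i) -> comb c q <= comb c' q.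
  move=> cc'; rewrite /comb; case: ifP => [/andP[p1 p2]|_]; last by case: ifP.
  by apply: lerD; apply: ler_wpM2l => //; lra.
have [C C0 HC] := IH _ (fun q j => comb (fun i => a i (lift ord0 j)) q).
pose S := \sum_i (`|a0 i| + \sum_j `|a i j|).
have S0 : 0 <= S.
  by apply: sumr_ge0 => i _; apply: addr_ge0 => //; apply: sumr_ge0.
have aS i : `|a0 i| + \sum_j `|a i j| <= S.
  rewrite /S (bigD1 i) //= lerDl; apply: sumr_ge0 => k _.
  by apply: addr_ge0 => //; apply: sumr_ge0.
(* [S] bounds the coefficients of the matrix, [K] the inverses of the pivots
   (a vanishing pivot adds nothing, as its inverse is 0). *)
pose K := \sum_i (`|a0 i|)^-1.
have K0 : 0 <= K by apply: sumr_ge0 => i _; rewrite invr_ge0.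
have aK i : (`|a0 i|)^-1 <= K.
  by rewrite /K (bigD1 i) //= lerDl; apply: sumr_ge0 => k _; rewrite invr_ge0.
pose C1 := C * (2 * S + 1).
have C10 : 0 <= C1 by apply: mulr_ge0 => //; lra.
pose C2 := (S * C1 + 1) * K.
have C20 : 0 <= C2 by apply: mulr_ge0 => //; rewrite addr_ge0 // mulr_ge0.
exists (C1 + C2); first exact: addr_ge0.
move=> b e e0 be [z zb].
pose rest (y : 'I_N -> R) i := \sum_j a i (lift ord0 j) * y j.
have sumE (y : 'I_N.+1 -> R) i :
    \sum_j a i j * y j = a0 i * y ord0 + rest (fun j => y (lift ord0 j)) i.
  by rewrite big_ord_recl.
have e'0 : 0 <= (2 * S + 1) * e by apply: mulr_ge0 => //; lra.
have comb_b q : - ((2 * S + 1) * e) <= comb b q.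
  have Se : 0 <= S * e by exact: mulr_ge0.
  have small i : `|a0 i| * e <= S * e.
    apply: ler_wpM2r => //; apply: le_trans (aS i).
    by rewrite lerDl; apply: sumr_ge0.
  rewrite /comb; case: ifP => [/andP[p1 p2]|_].
  - have := small q.1; have := small q.2.
    rewrite (gtr0_norm p1) (ltr0_norm p2) => s2 s1.
    have := ler_wpM2l (ltW p1) (be q.2).
    have : 0 <= - a0 q.2 by lra.
    by move=> /ler_wpM2l /(_ _ _ (be q.1)); lra.
  - case: ifP => _; last by lra.
    by have := be q.1; lra.
have [y yb yC] : exists2 y : 'I_N -> R,
    forall q, comb (rest y) q <= comb b q & forall j, `|y j| <= C1 * e.
  have [|y yb yC] := HC (comb b) _ e'0 comb_b.
    exists (fun j => z (lift ord0 j)) => q; rewrite comb_sum.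
    suff -> : comb (rest (fun j => z (lift ord0 j))) q
            = comb (fun i => \sum_j a i j * z j) q by exact: comb_le.
    rewrite /comb; case: ifP => _; first by rewrite !sumE; ring.
    by case: ifP => // /eqP q0; rewrite sumE q0; ring.
  exists y => [q|j]; first by have := yb q; rewrite comb_sum.
  by rewrite /C1 -mulrA.
have restS i : `|rest y i| <= S * (C1 * e).
  apply: (le_trans (ler_norm_sum _ _ _)).
  apply: (@le_trans _ _ (\sum_j `|a i (lift ord0 j)| * (C1 * e))).
    by apply: ler_sum => j _; rewrite normrM; apply: ler_wpM2l.
  rewrite -mulr_suml; apply: ler_wpM2r; first exact: mulr_ge0.
  apply: le_trans (aS i); rewrite big_ord_recl.
  by rewrite addrA lerDr addr_ge0.
pose bd i := (b i - rest y i) / a0 i.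
have bdE i : bd i = (rest y i - b i) * (- a0 i)^-1.
  by rewrite /bd invrN mulrN -mulNr opprB.
have num_le i : rest y i - b i <= (S * C1 + 1) * e.
  have := restS i; have := be i; have := ler_norm (rest y i); lra.
have D_ge x i : 0 <= x -> x <= (S * C1 + 1) * e -> x * `|a0 i|^-1 <= C2 * e.
  move=> x0 xle; rewrite /C2 mulrAC.
  apply: ler_pM => //; by rewrite invr_ge0.
have [||||z0 [zL zU zD]] := @exists_between R I (fun i => a0 i < 0)
    (fun i => 0 < a0 i) bd bd (C2 * e).
- exact: mulr_ge0.
- move=> i ai; have [neg|pos] := leP (rest y i - b i) 0.
    apply: (@le_trans _ _ 0); last exact: mulr_ge0.
    by rewrite bdE mulr_le0_ge0 // invr_ge0; lra.
  rewrite bdE -(ltr0_norm ai); exact: D_ge (ltW pos) (num_le i).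
- move=> i ai; rewrite lerNl /bd -mulNr opprB.
  have [neg|pos] := leP (rest y i - b i) 0.
    apply: (@le_trans _ _ 0); last exact: mulr_ge0.
    by rewrite mulr_le0_ge0 // invr_ge0; lra.
  rewrite -{1}(gtr0_norm ai); exact: D_ge (ltW pos) (num_le i).
- move=> i j ai aj; rewrite bdE /bd ler_pdivlMr // mulrAC ler_pdivrMr; last lra.
  by have := yb (j, i); rewrite /comb /= ai aj /=; lra.
exists (fun j => oapp y z0 (unlift ord0 j)) => [i|j].
  rewrite sumE unlift_none /=.
  have -> : rest (fun j => oapp y z0 (unlift ord0 (lift ord0 j))) i = rest y i.
    by apply: eq_bigr => j _; rewrite liftK.
  have [ai|ai|ai] := ltgtP (a0 i) 0.
  - by have := zL i ai; rewrite /bd ler_ndivrMr //; lra.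
  - by have := zU i ai; rewrite /bd ler_pdivlMr //; lra.
  - by have := yb (i, i); rewrite /comb /= ai ltxx /= eqxx; lra.
case: unliftP => [k _|_] /=; last first.
  by apply: (le_trans zD); rewrite ler_wpM2r // lerDr.
by apply: (le_trans (yC k)); rewrite ler_wpM2r // lerDl.
Qed.

(** Elimination needs an order on the variables; the statement does not. *)
Lemma small_solution (R : realFieldType) (J I : finType) (a : I -> J -> R) :
  exists2 C, 0 <= C & forall (b : I -> R) (e : R), 0 <= e ->
    (forall i, - e <= b i) ->
    (exists y : J -> R, forall i, \sum_j a i j * y j <= b i) ->
    exists2 y : J -> R, forall i, \sum_j a i j * y j <= b i
                      & forall j, `|y j| <= C * e.
Proof.
have [C C0 HC] := small_solution_ord (N := #|J|) (fun i k => a i (enum_val k)).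
exists C => // b e e0 be [y yb].
have [|z zb zC] := HC b e e0 be.
  exists (y \o enum_val) => i; have := yb i.
  by rewrite (reindex _ (onW_bij _ (enum_val_bij J))).
exists (z \o enum_rank) => [i|j] /=; last exact: zC.
rewrite (reindex _ (onW_bij _ (enum_val_bij J))) /=.
by under eq_bigr do rewrite enum_valK.
Qed.

(** * The t-product, the transpose and the inner product *)

Section TensorAlgebra.
Variables (R : realType).

Definition tdot (m l n : nat) (X Y : tensor R m l n) : R :=
  \sum_k \sum_i \sum_j X k i j * Y k i j.

(** The block circulant matrix acts as a cyclic convolution along the tubes. *)
Lemma tprodE (m l p n : nat) (A : tensor R m l n.+1) (X : tensor R l p n.+1)
    k i j :
  tprod A X k i j = \sum_s \sum_r A (k - s) i r * X s r j.
Proof.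
rewrite /tprod /fold /bcirc /unfold ffunE mul_mxblock_mxrow mxcolK summxE.
by apply: eq_bigr => s _; rewrite mxE.
Qed.

Lemma row_sliceE (m l n : nat) (A : tensor R m l n) i k i' j :
  row_slice i A k i' j = A k i j.
Proof. by rewrite ffunE mxE. Qed.

Lemma tensorDE (m l n : nat) (X Y : tensor R m l n) k i j :
  (X + Y) k i j = X k i j + Y k i j.
Proof. by rewrite [(X + Y) k]ffunE mxE. Qed.

Lemma tensorBE (m l n : nat) (X Y : tensor R m l n) k i j :
  (X - Y) k i j = X k i j - Y k i j.
Proof. by rewrite [(X - Y) k]ffunE [(- Y) k]ffunE !mxE. Qed.

Lemma tensorZE (m l n : nat) (c : R) (X : tensor R m l n) k i j :
  (c *: X) k i j = c * X k i j.
Proof. by rewrite [(c *: X) k]ffunE mxE. Qed.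

Lemma tprod_row_slice (m l p n : nat) (A : tensor R m l n.+1)
    (X : tensor R l p n.+1) i :
  tprod (row_slice i A) X = row_slice i (tprod A X).
Proof.
apply/ffunP => k; apply/matrixP => i' j; rewrite row_sliceE !tprodE.
by apply: eq_bigr => s _; apply: eq_bigr => r _; rewrite row_sliceE.
Qed.

Lemma tprodB (m l p n : nat) (A : tensor R m l n.+1) (X Y : tensor R l p n.+1) :
  tprod A (X - Y) = tprod A X - tprod A Y.
Proof.
apply/ffunP => k; apply/matrixP => i j; rewrite tensorBE !tprodE.
rewrite -sumrB; apply: eq_bigr => s _; rewrite -sumrB; apply: eq_bigr => r _.
by rewrite tensorBE mulrBr.
Qed.

Lemma tprodD (m l p n : nat) (A : tensor R m l n.+1) (X Y : tensor R l p n.+1) :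
  tprod A (X + Y) = tprod A X + tprod A Y.
Proof.
apply/ffunP => k; apply/matrixP => i j; rewrite tensorDE !tprodE.
rewrite -big_split; apply: eq_bigr => s _.
rewrite -big_split; apply: eq_bigr => r _.
by rewrite tensorDE mulrDr.
Qed.

Lemma fnorm_ge0 (m l n : nat) (X : tensor R m l n) : 0 <= fnorm X.
Proof. exact: sqrtr_ge0. Qed.

Lemma fnorm_sqr (m l n : nat) (X : tensor R m l n) : fnorm X ^+ 2 = tdot X X.
Proof.
rewrite /fnorm sqr_sqrtr; last first.
  by do 3! [apply: sumr_ge0 => ? _]; exact: sqr_ge0.
rewrite /tdot [RHS]exchange_big; apply: eq_bigr => i _.
by rewrite [RHS]exchange_big.
Qed.

Lemma tdotC (m l n : nat) (X Y : tensor R m l n) : tdot X Y = tdot Y X.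
Proof.
by do 3! [apply: eq_bigr => ? _]; rewrite mulrC.
Qed.

Lemma tdotBl (m l n : nat) (X Y Z : tensor R m l n) :
  tdot (X - Y) Z = tdot X Z - tdot Y Z.
Proof.
rewrite /tdot; do 3! [rewrite -sumrB; apply: eq_bigr => ? _].
by rewrite tensorBE mulrBl.
Qed.

Lemma tdotZl (m l n : nat) (c : R) (X Z : tensor R m l n) :
  tdot (c *: X) Z = c * tdot X Z.
Proof.
rewrite /tdot; do 3! [rewrite mulr_sumr; apply: eq_bigr => ? _].
by rewrite tensorZE mulrA.
Qed.

Lemma tdotBr (m l n : nat) (X Y Z : tensor R m l n) :
  tdot X (Y - Z) = tdot X Y - tdot X Z.
Proof. by rewrite tdotC tdotBl !(tdotC X). Qed.

Lemma tdotZr (m l n : nat) (c : R) (X Z : tensor R m l n) :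
  tdot X (c *: Z) = c * tdot X Z.
Proof. by rewrite tdotC tdotZl tdotC. Qed.

Lemma tdot_ge0 (m l n : nat) (X : tensor R m l n) : 0 <= tdot X X.
Proof. by rewrite -fnorm_sqr sqr_ge0. Qed.

Lemma tdot_eq0 (m l n : nat) (X : tensor R m l n) : (tdot X X == 0) = (X == 0).
Proof.
apply/eqP/eqP => [|->]; last first.
  by rewrite /tdot !big1 // => k _; rewrite big1 // => i _; rewrite big1 // => j _;
    rewrite !ffunE mxE mul0r.
move=> /eqP; rewrite psumr_eq0; last first.
  by move=> k _; do 2! [apply: sumr_ge0 => ? _]; rewrite -expr2 sqr_ge0.
move=> /allP X0; apply/ffunP => k; apply/matrixP => i j; rewrite !ffunE mxE.
have := X0 k (mem_index_enum _); rewrite psumr_eq0; last first.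
  by move=> ? _; apply: sumr_ge0 => ? _; rewrite -expr2 sqr_ge0.
move=> /allP /(_ i (mem_index_enum _)); rewrite psumr_eq0; last first.
  by move=> ? _; rewrite -expr2 sqr_ge0.
by move=> /allP /(_ j (mem_index_enum _)); rewrite mulf_eq0 orbb => /eqP.
Qed.

Lemma fnorm_gt0 (m l n : nat) (X : tensor R m l n) : (0 < fnorm X) = (X != 0).
Proof.
by rewrite lt_neqAle fnorm_ge0 andbT eq_sym -sqrf_eq0 fnorm_sqr tdot_eq0.
Qed.

(** Reversing the slices in the transpose is what turns the convolution index
    [k - s] into [s - k], so that the transpose is the adjoint. *)
Lemma tdot_ttr (m l p n : nat) (A : tensor R m l n.+1)
    (X : tensor R l p n.+1) (Z : tensor R m p n.+1) :
  tdot (tprod (ttr A) Z) X = tdot Z (tprod A X).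
Proof.
pose F k s i r j := Z k i j * (A (k - s) i r * X s r j).
transitivity (\sum_s \sum_r \sum_j \sum_k \sum_i F k s i r j).
  do 3! [apply: eq_bigr => ? _]; rewrite tprodE mulr_suml; apply: eq_bigr => k _.
  rewrite mulr_suml; apply: eq_bigr => i _.
  by rewrite !ffunE !mxE opprB /F; ring.
transitivity (\sum_k \sum_i \sum_j \sum_s \sum_r F k s i r j); last first.
  do 3! [apply: eq_bigr => ? _]; rewrite tprodE mulr_sumr; apply: eq_bigr => k _.
  by rewrite mulr_sumr.
under eq_bigr do under eq_bigr do rewrite exchange_big.
under eq_bigr do rewrite exchange_big.
rewrite exchange_big; apply: eq_bigr => k _ /=.
under eq_bigr do under eq_bigr do rewrite exchange_big.
under eq_bigr do rewrite exchange_big.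
rewrite exchange_big; apply: eq_bigr => i _ /=.
under eq_bigr do rewrite exchange_big.
by rewrite exchange_big.
Qed.

Lemma tdot_rows (m p n : nat) (Z : tensor R m p n) :
  \sum_i tdot (row_slice i Z) (row_slice i Z) = tdot Z Z.
Proof.
rewrite /tdot exchange_big; apply: eq_bigr => k _; apply: eq_bigr => i _ /=.
by rewrite big_ord1; apply: eq_bigr => j _; rewrite !row_sliceE.
Qed.

Lemma norm_entry_le (m l n : nat) (Z : tensor R m l n) k i j :
  `|Z k i j| <= fnorm Z.
Proof.
rewrite -ler_sqr ?nnegrE ?fnorm_ge0 // real_normK ?num_real // fnorm_sqr /tdot.
rewrite (bigD1 k) //= (bigD1 i) //= (bigD1 j) //= -expr2 -!addrA lerDl.
by rewrite !addr_ge0 //; do ?[apply: sumr_ge0 => ? _]; rewrite -expr2 sqr_ge0.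
Qed.

(** The constant is the Frobenius norm of the all-ones tensor. *)
Lemma fnorm_le_entries (m l n : nat) (Z : tensor R m l n) D : 0 <= D ->
  (forall k i j, `|Z k i j| <= D) ->
  fnorm Z <= Num.sqrt (n * m * l)%:R * D.
Proof.
move=> D0 ZD.
rewrite -ler_sqr ?nnegrE ?fnorm_ge0 ?mulr_ge0 ?sqrtr_ge0 // exprMn.
rewrite fnorm_sqr sqr_sqrtr //.
apply: (@le_trans _ _ (\sum_(k < n) \sum_(i < m) \sum_(j < l) D ^+ 2)).
  do 3! [apply: ler_sum => ? _]; rewrite -expr2 -real_normK ?num_real //.
  by rewrite ler_sqr ?nnegrE // ZD.
rewrite !sumr_const !card_ord -!mulrnA mulr_natl.
by rewrite -[in leRHS]mulnA [in leRHS]mulnC [in leRHS](mulnC m) mulnA.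
Qed.

End TensorAlgebra.

(** * The discrete Fourier transform bounds the operator norm of a row slice *)

Section SpectralBound.
Variable R : realType.
Local Open Scope complex_scope.
Import ComplexField.Normc.
Local Notation C := R[i].
Local Notation "x %:C" := (real_complex R x) : complex_scope.

Lemma normc_sqrE (z : C) : (normc z ^+ 2)%:C = z * conjc z.
Proof.
case: z => a b; rewrite /normc sqr_sqrtr ?addr_ge0 ?sqr_ge0 //.
by apply/eqP; rewrite eq_complex /=; apply/andP; split; apply/eqP; ring.
Qed.

Lemma normc_sqrM (y z : C) : normc (y * z) ^+ 2 = normc y ^+ 2 * normc z ^+ 2.
Proof. by rewrite normcM exprMn. Qed.

Lemma normc_sqr_conj (z : C) : normc (conjc z) ^+ 2 = normc z ^+ 2.
Proof. by apply: complexI; rewrite !normc_sqrE conjcK mulrC. Qed.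

Lemma normc_sqr_real (x : R) : normc x%:C ^+ 2 = x ^+ 2.
Proof.
by apply: complexI; rewrite normc_sqrE conjc_real -rmorphM.
Qed.

Lemma dft_rootX (N k : nat) :
  dft_root R N ^+ k =
  Complex (cos (2 * pi / N%:R *+ k)) (- sin (2 * pi / N%:R *+ k)).
Proof.
elim: k => [|k IH]; first by rewrite expr0 mulr0n cos0 sin0 oppr0.
rewrite exprS IH /dft_root (mulrS (2 * pi / N%:R)) cosD sinD.
by apply/eqP; rewrite eq_complex /=; apply/andP; split; apply/eqP; ring.
Qed.

Lemma cos_lt1 (x : R) : 0 < x < 2 * pi -> cos x < 1.
Proof.
move=> /andP[x0 x2].
have -> : x = (x / 2) *+ 2 by rewrite -mulr_natr; field.
have s0 : 0 < sin (x / 2) by apply: sin_gt0_pi; apply/andP; split; lra.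
have : 0 < sin (x / 2) ^+ 2 by rewrite exprn_gt0.
by rewrite cos_mulr2n cos2sin2 mulr2n; lra.
Qed.

Lemma dft_root_prim (n : nat) : n.+1.-primitive_root (dft_root R n.+1).
Proof.
have n0 : (n.+1%:R : R) != 0 by rewrite pnatr_eq0.
have th i : 2 * pi / n.+1%:R *+ i = 2 * pi * (i%:R / n.+1%:R) :> R.
  by rewrite -mulr_natr; field.
rewrite /primitive_root_of_unity /=; apply/forallP => i.
rewrite unity_rootE dft_rootX th; have [->|ne] := eqVneq i.+1 n.+1.
  rewrite divff // mulr1 mulrC mulr_natr cos2pi sin2pi oppr0.
  by apply/eqP; exact: eqxx.
apply/eqP/negbTE; rewrite eq_complex negb_and; apply/orP; left.
rewrite lt_eqF //; apply: cos_lt1.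
have pi0 := pi_gt0 R.
have q0 : 0 < i.+1%:R / n.+1%:R :> R by rewrite divr_gt0 // ltr0n.
have q1 : i.+1%:R / n.+1%:R < 1 :> R.
  by rewrite ltr_pdivrMr ?ltr0n // mul1r ltr_nat ltn_neqAle ne ltn_ord.
apply/andP; split; first by apply: mulr_gt0 => //; lra.
by rewrite -[ltRHS]mulr1 ltr_pM2l //; lra.
Qed.

Lemma dft_root_conj (n : nat) : dft_root R n * conjc (dft_root R n) = 1.
Proof.
apply/eqP; rewrite eq_complex /=; apply/andP; split; apply/eqP; last ring.
by rewrite mulrN opprK -!expr2 sqrrN cos2Dsin2.
Qed.

(** The matrix of the powers of a primitive root of unity of modulus 1 has
    orthogonal rows: for distinct [s] and [s'], the powers of the root of
    unity [w ^+ s * conjc w ^+ s'], which is not 1, sum to 0. *)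
Lemma parseval (n : nat) (w : C) (u : 'I_n.+1 -> C) :
  n.+1.-primitive_root w -> w * conjc w = 1 ->
  \sum_(k < n.+1) normc (\sum_(s < n.+1) w ^+ (k * s) * u s) ^+ 2 =
  n.+1%:R * \sum_s normc (u s) ^+ 2.
Proof.
move=> wp ww; apply: complexI.
rewrite rmorphM rmorph_nat !rmorph_sum /=.
have orth (s s' : 'I_n.+1) :
    \sum_(k < n.+1) (w ^+ s * (conjc w) ^+ s') ^+ k = n.+1%:R * (s == s')%:R.
  have wwX j : w ^+ j * (conjc w) ^+ j = 1 by rewrite -exprMn ww expr1n.
  have [->|ne] := eqVneq s s'.
    rewrite wwX mulr1 (eq_bigr (fun => 1)) => [|k _]; last exact: expr1n.
    by rewrite sumr_const card_ord.
  set z := _ * _; rewrite mulr0.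
  have z1 : z != 1.
    apply/eqP => z1; move/eqP: ne; apply; apply: val_inj => /=.
    have : w ^+ s == w ^+ s'.
      by rewrite -[w ^+ s]mulr1 -(wwX s') mulrCA -/z z1 mulr1.
    by rewrite (eq_prim_root_expr wp) !modn_small // => /eqP.
  have zn : z ^+ n.+1 = 1.
    rewrite /z exprMn -!exprM ![(_ * n.+1)%N]mulnC !exprM -rmorphXn.
    by rewrite (prim_expr_order wp) rmorph1 !expr1n mulr1.
  apply/eqP; have /eqP := subrX1 z n.+1.
  by rewrite zn subrr eq_sym mulf_eq0 subr_eq0 (negbTE z1).
transitivity (\sum_(s < n.+1) \sum_(s' < n.+1) (u s * conjc (u s')) *
                \sum_(k < n.+1) (w ^+ s * (conjc w) ^+ s') ^+ k).
  under [RHS]eq_bigr do under eq_bigr do rewrite mulr_sumr.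
  under [RHS]eq_bigr do rewrite exchange_big.
  rewrite [RHS]exchange_big; apply: eq_bigr => k _ /=.
  rewrite normc_sqrE rmorph_sum mulr_suml; apply: eq_bigr => s _.
  rewrite mulr_sumr; apply: eq_bigr => s' _.
  rewrite rmorphM rmorphXn exprMn -!exprM !(mulnC k) /=; ring.
rewrite mulr_sumr; apply: eq_bigr => s _.
under eq_bigr do rewrite orth.
rewrite (bigD1 s) //= big1 ?addr0 => [|s' ne].
  by rewrite eqxx mulr1 normc_sqrE mulrC.
by rewrite eq_sym (negbTE ne) !mulr0.
Qed.

Lemma dftE (m l n : nat) (A : tensor R m l n.+1) k i j :
  dft A k i j = \sum_(s < n.+1) dft_root R n.+1 ^+ (k * s) * (A s i j)%:C.
Proof.
rewrite ffunE mxE mulr_sumr; apply: eq_bigr => s _.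
by rewrite mxE !mulrA -rmorphM divff ?rmorph1 ?mul1r.
Qed.

Lemma dft_parseval (m l n : nat) (Z : tensor R m l n.+1) :
  \sum_k fnormC (dft Z k) ^+ 2 = n.+1%:R * tdot Z Z.
Proof.
have -> : tdot Z Z = \sum_i \sum_j \sum_k Z k i j ^+ 2.
  rewrite /tdot exchange_big; apply: eq_bigr => i _.
  by rewrite exchange_big.
transitivity (\sum_k \sum_i \sum_j normc (dft Z k i j) ^+ 2).
  apply: eq_bigr => k _; rewrite /fnormC sqr_sqrtr //.
  by do 2! [apply: sumr_ge0 => ? _]; exact: sqr_ge0.
rewrite exchange_big mulr_sumr; apply: eq_bigr => i _ /=.
rewrite exchange_big mulr_sumr; apply: eq_bigr => j _ /=.
under eq_bigr do rewrite dftE.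
rewrite (parseval _ (dft_root_prim n) (dft_root_conj _)).
by congr (_ * _); apply: eq_bigr => s _; exact: normc_sqr_real.
Qed.

(** The transform turns the convolution into a product, slice by slice, and
    the reversal in the transpose into a conjugation. *)
Lemma dft_ttr_prod (l p n : nat) (A : tensor R 1 l n.+1)
    (Z : tensor R 1 p n.+1) k i j :
  dft (tprod (ttr A) Z) k i j = conjc (dft A k ord0 i) * dft Z k ord0 j.
Proof.
rewrite !dftE; set w := dft_root R n.+1.
have wn : (w ^+ k) ^+ n.+1 = 1.
  by rewrite -exprM mulnC exprM (prim_expr_order (dft_root_prim n)) expr1n.
have shift (v t : 'I_n.+1) :
    w ^+ (k * t) = w ^+ (k * (t + v)%R) * (conjc w) ^+ (k * v).
  rewrite !exprM /= (expr_mod _ wn) exprD -mulrA.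
  by rewrite -exprMn -exprMn dft_root_conj !expr1n mulr1.
transitivity (\sum_(t < n.+1) \sum_(s < n.+1) w ^+ (k * s) * (Z s ord0 j)%:C *
   ((conjc w) ^+ (k * (s - t)%R) * (A (s - t) ord0 i)%:C)).
  apply: eq_bigr => t _; rewrite tprodE rmorph_sum mulr_sumr.
  apply: eq_bigr => s _; rewrite big_ord1 ffunE mxE opprB rmorphM (shift (s - t) t).
  by rewrite [t + _]addrC subrK; ring.
rewrite exchange_big mulrC mulr_suml; apply: eq_bigr => s _.
rewrite -mulr_sumr; congr (_ * _).
rewrite (reindex_inj (h := fun t => s - t)); last first.
  by move=> t t' /addrI /oppr_inj.
rewrite (rmorph_sum (@conjc R)); apply: eq_bigr => t _; rewrite subKr.
rewrite (rmorphM (@conjc R)) (rmorphXn (@conjc R)); congr (_ * _).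
exact/esym/conjc_real.
Qed.

(** For a matrix of rank one the Frobenius norm is multiplicative. This is why
    the Frobenius norms of the transformed slices, and not only their spectral
    norms, give a sharp bound for a row slice. *)
Lemma fnormC_outer (l p : nat) (M : 'M[C]_(l, p)) (a : 'M[C]_(1, l))
    (z : 'M[C]_(1, p)) :
  (forall i j, M i j = conjc (a ord0 i) * z ord0 j) ->
  fnormC M ^+ 2 = fnormC a ^+ 2 * fnormC z ^+ 2.
Proof.
move=> ME; rewrite /fnormC !sqr_sqrtr; try by
  do 2! [apply: sumr_ge0 => ? _]; exact: sqr_ge0.
rewrite !big_ord1 mulr_suml; apply: eq_bigr => i _.
rewrite mulr_sumr; apply: eq_bigr => j _.
by rewrite ME normc_sqrM normc_sqr_conj.
Qed.

(** By Parseval the squared norms of both sides can be compared in the Fourier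
    domain, where the operator acts on each slice separately. *)
Lemma ttr_prod_bound (l p n : nat) (A : tensor R 1 l n.+1)
    (Z : tensor R 1 p n.+1) :
  tdot (tprod (ttr A) Z) (tprod (ttr A) Z) <= max_slice_norm2 A * tdot Z Z.
Proof.
rewrite -(ler_pM2l (_ : 0 < n.+1%:R)) ?ltr0n // mulrCA -!dft_parseval mulr_sumr.
apply: ler_sum => k _.
rewrite (fnormC_outer (dft_ttr_prod A Z k)) ler_wpM2r ?sqr_ge0 //.
exact: le_bigmax.
Qed.

End SpectralBound.

(** * Distance to a set of tensors *)

Section DistanceToSet.
Variables (R : realType) (m l n : nat).
Implicit Types (X Y : tensor R m l n) (Om : set (tensor R m l n)).

Lemma tdist_ge0 X Om : 0 <= tdist X Om.
Proof.
have [->|/set0P[Y OmY]] := eqVneq Om set0; first by rewrite /tdist image_set0 inf0.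
by apply: lb_le_inf; [exists (fnorm (X - Y)), Y|move=> _ [Z _ <-]; exact: fnorm_ge0].
Qed.

Lemma tdist_le X Y Om : Om Y -> tdist X Om <= fnorm (X - Y).
Proof.
move=> OmY; apply: ge_inf; last by exists Y.
by exists 0 => _ [Z _ <-]; exact: fnorm_ge0.
Qed.

(** The distance is an infimum; comparing it through all points of the set
    avoids projecting onto the set. *)
Lemma le_tdist_sqr X Om c : Om !=set0 ->
  (forall Y, Om Y -> c <= tdot (X - Y) (X - Y)) -> c <= tdist X Om ^+ 2.
Proof.
move=> [Y0 OmY0] cY; have [c0|c0] := leP c 0.
  by apply: le_trans c0 _; exact: sqr_ge0.
rewrite -[c]sqr_sqrtr ?(ltW c0) // ler_sqr ?nnegrE ?sqrtr_ge0 ?tdist_ge0 //.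
apply: lb_le_inf; first by exists (fnorm (X - Y0)), Y0.
move=> _ [Y OmY <-].
rewrite -(@ler_pXn2r _ 2) ?nnegrE ?sqrtr_ge0 ?fnorm_ge0 // fnorm_sqr.
by rewrite sqr_sqrtr ?(ltW c0) //; exact: cY.
Qed.

End DistanceToSet.

(** * One step of the algorithm, and the Hoffman constant *)

Section TRKL.
Variables (R : realType) (m l p n : nat).
Variables (A : tensor R m.+1 l.+1 n.+1) (B : tensor R m.+1 p.+1 n.+1).
Variables (Ile Ieq : {set 'I_m.+1}) (t : 'I_m.+1 -> R).
Hypothesis A_neq0 : forall i, row_slice i A != 0.
Hypothesis disjoint_rows : (Ile :&: Ieq)%SET = finset.set0.
Hypothesis cover_rows : (Ile :|: Ieq)%SET = finset.setT.
Hypothesis feasible_neq0 : @feasible R _ _ p.+1 _ A B Ile Ieq !=set0.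
Hypothesis t_bounds : forall i, 0 < t i <
     2 * fnorm (row_slice i A) ^+ 2 / max_slice_norm2 (row_slice i A).

Local Notation Om := (feasible A B Ile Ieq).
Local Notation residual X := (cT Ile (tprod A X - B)).
Local Notation rowres i X := (row_slice i (residual X)).
Local Notation gain i :=
  (2 * t i * (1 - t i * max_slice_norm2 (row_slice i A) /
                      (2 * fnorm (row_slice i A) ^+ 2))).

Lemma cTE (Z : tensor R m.+1 p.+1 n.+1) k i j :
  cT Ile Z k i j = if i \in Ile then Num.max (Z k i j) 0 else Z k i j.
Proof. by rewrite ffunE mxE. Qed.

Lemma equality_row i : i \notin Ile -> i \in Ieq.
Proof.
by move=> iNle; have := finset.in_setT i; rewrite -cover_rows inE (negbTE iNle).
Qed.

Lemma equality_rowN i : i \in Ieq -> i \notin Ile.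
Proof.
move=> iIeq; apply/negP => iIle.
by have := finset.in_set0 i; rewrite -disjoint_rows inE iIle iIeq.
Qed.

Lemma row_gt0 i : 0 < fnorm (row_slice i A) ^+ 2.
Proof. by rewrite exprn_gt0 // fnorm_gt0. Qed.

(** Division by zero gives 0, which would leave no room for [t i]. *)
Lemma max_slice_gt0 i : 0 < max_slice_norm2 (row_slice i A).
Proof.
rewrite lt_neqAle; apply/andP; split; last first.
  rewrite /max_slice_norm2; apply: (big_ind (fun x => 0 <= x)) => // [x y x0 y0|j _].
    by rewrite le_max x0.
  exact: sqr_ge0.
apply/eqP => M0; have /andP[t0] := t_bounds i.
by rewrite -M0 invr0 mulr0 => /(lt_trans t0); rewrite ltxx.
Qed.

Lemma gain_gt0 i : 0 < gain i.
Proof.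
have /andP[t0] := t_bounds i; rewrite ltr_pdivlMr ?max_slice_gt0 // => tM.
rewrite mulr_gt0 ?mulr_gt0 // subr_gt0 ltr_pdivrMr ?mul1r //.
by rewrite mulr_gt0 // row_gt0.
Qed.

(** The positive part of an inequality residual and the plain residual of an
    equality are both the row of [cT Ile]; this gives a single formula for the
    two kinds of steps. *)
Lemma trkl_stepE i (X : tensor R l.+1 p.+1 n.+1) :
  trkl_step A B Ile t i X =
  X - (t i / fnorm (row_slice i A) ^+ 2) *:
      tprod (ttr (row_slice i A)) (rowres i X).
Proof.
rewrite /trkl_step; congr (_ - _ *: tprod _ _).
apply/ffunP => k; apply/matrixP => i' j; rewrite row_sliceE cTE.
case: ifP => _; last by rewrite !tensorBE tprod_row_slice !row_sliceE.
by rewrite ffunE mxE !tensorBE tprod_row_slice !row_sliceE.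
Qed.

(** Where an inequality residual is positive, [A * Y <= B] makes the change
    from [Y] to [X] at least that residual; elsewhere the row of [cT]
    vanishes. On equality rows both sides agree. *)
Lemma residual_le_inner i (X Y : tensor R l.+1 p.+1 n.+1) : Om Y ->
  tdot (rowres i X) (rowres i X) <=
  tdot (rowres i X) (tprod (row_slice i A) (X - Y)).
Proof.
move=> [Yle Yeq].
apply: ler_sum => k _; apply: ler_sum => i' _; apply: ler_sum => j _.
rewrite tprodB tensorBE !tprod_row_slice !row_sliceE cTE tensorBE.
have [iIle|iNle] := boolP (i \in Ile); last first.
  have /ffunP/(_ k)/matrixP/(_ i' j) := Yeq i (equality_row iNle).
  by rewrite tprod_row_slice !row_sliceE => ->.
have := Yle i iIle k i' j; rewrite tprod_row_slice !row_sliceE.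
by rewrite maxEle; case: ifP => res0 Yb; [rewrite !mul0r|nra].
Qed.

(** With [s = t i / fnorm (row_slice i A) ^+ 2], expanding the square, the
    cross term gains [2 * s] times the squared residual by [residual_le_inner]
    and the quadratic term costs at most [s ^+ 2 * max_slice_norm2] times it
    by [ttr_prod_bound]. *)
Lemma step_to_feasible i (X Y : tensor R l.+1 p.+1 n.+1) : Om Y ->
  tdot (trkl_step A B Ile t i X - Y) (trkl_step A B Ile t i X - Y) <=
  tdot (X - Y) (X - Y) -
    gain i / fnorm (row_slice i A) ^+ 2 * tdot (rowres i X) (rowres i X).
Proof.
move=> OmY; rewrite trkl_stepE; set r := rowres i X.
set a := fnorm _ ^+ 2; set s := t i / a; set W := tprod (ttr _) r.
have a0 : 0 < a := row_gt0 i.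
have s0 : 0 < s by rewrite divr_gt0 //; case/andP: (t_bounds i).
rewrite addrAC; set D := X - Y.
have WD : tdot r r <= tdot W D by rewrite tdot_ttr; exact: residual_le_inner.
have WW : tdot W W <= max_slice_norm2 (row_slice i A) * tdot r r.
  exact: ttr_prod_bound.
clearbody D W.
rewrite tdotBl !tdotBr !tdotZl !tdotZr (tdotC D W).
have := ler_wpM2l (ltW s0) WD; have := ler_wpM2l (sqr_ge0 s) WW.
have -> : gain i / a * tdot r r =
    2 * (s * tdot r r) - s ^+ 2 * (max_slice_norm2 (row_slice i A) * tdot r r).
  by rewrite -/a /s; field; rewrite gt_eqF.
by rewrite (expr2 s) -!mulrA; lra.
Qed.

Lemma tdist_step i (X : tensor R l.+1 p.+1 n.+1) :
  tdist (trkl_step A B Ile t i X) Om ^+ 2 <=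
  tdist X Om ^+ 2 -
    gain i / fnorm (row_slice i A) ^+ 2 * tdot (rowres i X) (rowres i X).
Proof.
rewrite lerBrDr; apply: le_tdist_sqr => // Y OmY.
rewrite -lerBrDr; apply: le_trans (step_to_feasible i X OmY).
by rewrite -fnorm_sqr ler_sqr ?nnegrE ?tdist_ge0 ?fnorm_ge0 //; exact: tdist_le.
Qed.

(** A step decreases the squared distance by a positive multiple of the
    squared residual and leaves it nonnegative. *)
Lemma tdist_gt0 i (X : tensor R l.+1 p.+1 n.+1) :
  rowres i X != 0 -> 0 < tdist X Om.
Proof.
move=> r0; rewrite lt_neqAle tdist_ge0 andbT eq_sym -sqrf_eq0 gt_eqF //.
have := tdist_step i X; set r := rowres i X.
have : 0 < gain i / fnorm (row_slice i A) ^+ 2 * tdot r r.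
  by rewrite mulr_gt0 ?divr_gt0 ?gain_gt0 ?row_gt0 // -fnorm_sqr exprn_gt0 // fnorm_gt0.
have := sqr_ge0 (tdist (trkl_step A B Ile t i X) Om); lra.
Qed.

(** A tensor that reproduces in one entry the squared norm of the row slice,
    scaled so that the residual of that entry is 1, positive whichever kind of
    constraint the row is. *)
Lemma infeasible_point i :
  exists X : tensor R l.+1 p.+1 n.+1, rowres i X != 0.
Proof.
have a0 := row_gt0 i.
pose D : tensor R l.+1 p.+1 n.+1 := [ffun s => \matrix_(r, j) A (- s) i r].
have AD : tprod A D ord0 i ord0 = fnorm (row_slice i A) ^+ 2.
  rewrite tprodE fnorm_sqr /tdot (reindex_inj oppr_inj); apply: eq_bigr => s _.
  rewrite big_ord1; apply: eq_bigr => r _; rewrite !row_sliceE ffunE mxE.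
  by rewrite sub0r !opprK.
pose c := (B ord0 i ord0 + 1) / fnorm (row_slice i A) ^+ 2.
exists (c *: D); apply/eqP => /ffunP/(_ ord0)/matrixP/(_ ord0 ord0).
have AcD : (tprod A (c *: D) - B) ord0 i ord0 = 1.
  rewrite tensorBE tprodE.
  under eq_bigr do under eq_bigr do rewrite tensorZE mulrCA.
  under eq_bigr do rewrite -mulr_sumr.
  rewrite -mulr_sumr -tprodE AD /c divfK ?gt_eqF //; ring.
rewrite row_sliceE cTE AcD !ffunE mxE (max_idPl ler01).
by case: ifP => _ /eqP; rewrite oner_eq0.
Qed.

(** [small_solution] applied to the displacement from [X], with the right-hand
    side [B - A * X]. Each entry gives the inequality for the sign [+] and, on
    an equality row, the opposite one; [sgn] is 0 for the opposite of an
    inequality row, which leaves the trivial constraint. *)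
Lemma hoffman_bounds_neq0 : @hoffman_bounds R _ _ p.+1 _ A B Ile Ieq !=set0.
Proof.
pose J : finType := ('I_n.+1 * ('I_l.+1 * 'I_p.+1))%type.
pose K : finType := ('I_n.+1 * ('I_m.+1 * 'I_p.+1))%type.
pose coef (c : K) (x : J) : R :=
  A (c.1 - x.1) c.2.1 x.2.1 * (c.2.2 == x.2.2)%:R.
pose sgn (q : bool * K) : R :=
  if q.1 then 1 else if q.2.2.1 \in Ile then 0 else - 1.
pose toT (y : J -> R) : tensor R l.+1 p.+1 n.+1 :=
  [ffun s => \matrix_(r, j) y (s, (r, j))].
have toTE y s r j : toT y s r j = y (s, (r, j)) by rewrite ffunE mxE.
have coefE (y : J -> R) (c : K) :
    \sum_x coef c x * y x = tprod A (toT y) c.1 c.2.1 c.2.2.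
  transitivity (\sum_s \sum_r \sum_j coef c (s, (r, j)) * y (s, (r, j))).
    under [RHS]eq_bigr do rewrite pair_bigA.
    by rewrite pair_bigA; apply: eq_bigr => -[s [r j]] _.
  rewrite tprodE; apply: eq_bigr => s _; apply: eq_bigr => r _.
  rewrite (bigD1 c.2.2) //= big1 => [|j ne].
    by rewrite /coef /= eqxx mulr1 addr0 toTE.
  by rewrite /coef /= eq_sym (negbTE ne) mulr0 mul0r.
have [C C0 HC] := small_solution (fun q x => sgn q * coef q.2 x).
have sgnE (y : J -> R) q :
    \sum_x sgn q * coef q.2 x * y x = sgn q * tprod A (toT y) q.2.1 q.2.2.1 q.2.2.2.
  by rewrite -coefE mulr_sumr; apply: eq_bigr => x _; rewrite mulrA.
exists (Num.sqrt (n.+1 * l.+1 * p.+1)%:R * C) => X.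
set e := fnorm (residual X).
have e0 : 0 <= e by exact: fnorm_ge0.
have [Y0 [Y0le Y0eq]] := feasible_neq0.
pose b (q : bool * K) := sgn q * (B - tprod A X) q.2.1 q.2.2.1 q.2.2.2.
have [||y yb yC] := HC b e e0.
- move=> [s [k [i j]]]; rewrite /b /sgn /=.
  have := norm_entry_le (residual X) k i j; rewrite -/e cTE !tensorBE ler_norml.
  by case: ifP => _; case: s => /=; move=> /andP[]; rewrite ?ge_max ?le_max; lra.
- exists (fun x => (Y0 - X) x.1 x.2.1 x.2.2) => q; rewrite sgnE /b.
  have -> : toT (fun x => (Y0 - X) x.1 x.2.1 x.2.2) = Y0 - X.
    by apply/ffunP => s; apply/matrixP => r j; rewrite toTE.
  move: q => [s [k [i j]]]; rewrite tprodB !tensorBE /sgn /=.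
  have [iIle|iNle] := boolP (i \in Ile).
    have := Y0le i iIle k ord0 j; rewrite tprod_row_slice !row_sliceE.
    by case: s; lra.
  have /ffunP/(_ k)/matrixP/(_ ord0 j) := Y0eq i (equality_row iNle).
  by rewrite tprod_row_slice !row_sliceE => ->; case: s; lra.
have OmXy : Om (X + toT y).
  split=> i Hi.
    move=> k i' j; rewrite tprod_row_slice !row_sliceE tprodD tensorDE.
    have := yb (true, (k, (i, j))); rewrite sgnE /b /sgn /= !mul1r tensorBE; lra.
  apply/ffunP => k; apply/matrixP => i' j.
  rewrite tprod_row_slice !row_sliceE tprodD tensorDE.
  have := yb (true, (k, (i, j))); have := yb (false, (k, (i, j))).
  rewrite !sgnE /b /sgn /= (negbTE (equality_rowN Hi)) !mul1r !mulN1r tensorBE.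
  by move=> h1 h2; apply/eqP; rewrite eq_le; apply/andP; split; lra.
apply: (le_trans (tdist_le X OmXy)); rewrite opprD addrA subrr add0r -mulrA.
apply: fnorm_le_entries; first exact: mulr_ge0.
by move=> s r j; rewrite [(- toT y) s]ffunE mxE normrN toTE; exact: yC.
Qed.

(** At an infeasible point the distance is positive. *)
Lemma hoffman_bounds_gt0 g : @hoffman_bounds R _ _ p.+1 _ A B Ile Ieq g -> 0 < g.
Proof.
have [X /tdist_gt0 dX] := infeasible_point ord0.
move=> /(_ X) /(lt_le_trans dX) gr; have := fnorm_ge0 (residual X).
by rewrite le_eqVlt => /predU1P[r0|r0];
  [move: gr; rewrite -r0 mulr0 ltxx|move: gr; rewrite pmulr_lgt0].
Qed.

(** Each point imposes a closed condition on the constant, so the infimum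
    satisfies it; where the residual vanishes the condition no longer involves
    the constant. *)
Lemma least_hoffman_bound :
  least (@hoffman_bounds R _ _ p.+1 _ A B Ile Ieq)
        (inf (@hoffman_bounds R _ _ p.+1 _ A B Ile Ieq)).
Proof.
set S := hoffman_bounds _ _ _ _.
have Slb : has_lbound S by exists 0 => g /hoffman_bounds_gt0 /ltW.
split; last by move=> g Sg; exact: ge_inf.
move=> X; have := fnorm_ge0 (residual X); rewrite le_eqVlt => /predU1P[r0|r0].
  have [g Sg] := hoffman_bounds_neq0.
  by have := Sg X; rewrite -r0 !mulr0.
rewrite -ler_pdivrMr //; apply: lb_le_inf; first exact: hoffman_bounds_neq0.
by move=> g Sg; rewrite ler_pdivrMr //; exact: Sg.
Qed.

Lemma min_gain_gt0 : 0 < min_ord (fun i => gain i).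
Proof.
rewrite /min_ord; apply: (big_ind (fun x => 0 < x)) => [|x y x0 y0|i _].
- exact: gain_gt0.
- by rewrite lt_min x0.
- exact: gain_gt0.
Qed.

Lemma fnorm_A_gt0 : 0 < fnorm A ^+ 2.
Proof.
rewrite fnorm_sqr -tdot_rows (bigD1 ord0) //= ltr_wpDr //.
  by apply: sumr_ge0 => i _; exact: tdot_ge0.
by rewrite -fnorm_sqr row_gt0.
Qed.

Lemma trkl_rate_lt1 g : 0 < g -> trkl_rate A t g < 1.
Proof.
move=> g0; rewrite /trkl_rate ltrBlDr ltrDl mulr_gt0 ?min_gain_gt0 //.
by rewrite divr_gt0 // mulr_gt0 ?fnorm_A_gt0 // exprn_gt0.
Qed.

(** The weight of row [i] cancels the squared norm in the denominator of its
    gain, so the mean decrease is at least the smallest gain times the full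
    squared residual over [fnorm A ^+ 2]; the Hoffman bound compares that
    residual with the distance. *)
Lemma expected_step g (X : tensor R l.+1 p.+1 n.+1) :
  @hoffman_bounds R _ _ p.+1 _ A B Ile Ieq g ->
  \sum_i fnorm (row_slice i A) ^+ 2 / fnorm A ^+ 2 *
      tdist (trkl_step A B Ile t i X) Om ^+ 2 <=
  trkl_rate A t g * tdist X Om ^+ 2.
Proof.
move=> Sg; have g0 := hoffman_bounds_gt0 Sg.
have a0 := fnorm_A_gt0; set a := fnorm A ^+ 2 in a0 *.
set d2 := tdist X Om ^+ 2; set mu := min_ord (fun i => gain i).
have sum1 : \sum_i fnorm (row_slice i A) ^+ 2 / a = 1.
  rewrite -mulr_suml; under eq_bigr do rewrite fnorm_sqr.
  by rewrite tdot_rows -fnorm_sqr divff ?gt_eqF.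
apply: (@le_trans _ _ (d2 - mu / a * fnorm (residual X) ^+ 2)).
  rewrite fnorm_sqr -tdot_rows mulr_sumr -[d2]mul1r -sum1 mulr_suml -sumrB.
  apply: ler_sum => i _.
  have q0 : 0 <= fnorm (row_slice i A) ^+ 2 / a by rewrite divr_ge0 ?sqr_ge0 ?ltW.
  apply: (le_trans (ler_wpM2l q0 (tdist_step i X))); rewrite mulrBr lerD2l lerN2.
  rewrite mulrA [X in _ <= X * _](_ : _ = gain i / a); last first.
    by rewrite mulrC mulrA divfK // gt_eqF // row_gt0.
  rewrite ler_wpM2r ?tdot_ge0 // ler_wpM2r ?invr_ge0 ?(ltW a0) //.
  by rewrite /mu /min_ord; exact: bigmin_le.
rewrite /trkl_rate -/mu -/a mulrBl div1r mul1r lerD2l lerN2.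
have dg : d2 <= g ^+ 2 * fnorm (residual X) ^+ 2.
  by rewrite -exprMn ler_sqr ?nnegrE ?tdist_ge0 ?mulr_ge0 ?(ltW g0) ?fnorm_ge0.
have g20 : 0 < g ^+ 2 by rewrite exprn_gt0.
rewrite invfM -!mulrA ler_wpM2l ?(ltW min_gain_gt0) //.
by rewrite mulrCA ler_wpM2l ?invr_ge0 ?(ltW a0) // ler_pdivrMl.
Qed.

End TRKL.

(** * Conditional expectation along finitely many histories *)

Section FiniteSigma.
Variables (T : pointedType) (G : set (set T)).

Lemma sigma_fin_bigcup (I : finType) (D : set I) (F : I -> set T) :
  (forall i, D i -> <<s G >> (F i)) -> <<s G >> (\bigcup_(i in D) F i).
Proof.
by move=> GF; apply: (@fin_bigcup_measurable _ (g_sigma_algebraType G)).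
Qed.

Lemma sigma_fin_bigcap (I : finType) (D : set I) (F : I -> set T) :
  (forall i, D i -> <<s G >> (F i)) -> <<s G >> (\bigcap_(i in D) F i).
Proof.
by move=> GF; apply: (@fin_bigcap_measurable _ (g_sigma_algebraType G)).
Qed.

Lemma sigmaI (E F : set T) : <<s G >> E -> <<s G >> F -> <<s G >> (E `&` F).
Proof. exact: (@measurableI _ (g_sigma_algebraType G)). Qed.

End FiniteSigma.

Section FiniteValued.
Variables (R : realType) (d : measure_display) (T : measurableType d).
Variable P : probability T R.
Variables (V : finType) (W : T -> V).
Hypothesis mW : forall v, measurable (W @^-1` [set v]).

Lemma measurable_preimage_fin (Q : set V) : measurable (W @^-1` Q).
Proof.
rewrite [_ @^-1` _](_ : _ = \bigcup_(v in Q) W @^-1` [set v]).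
  by exact: fin_bigcup_measurable.
by apply/seteqP; split => [w Qw|w [v Qv /= ->//]]; exists (W w).
Qed.

Lemma measurable_fun_fin (F : V -> R) : measurable_fun setT (fun w => F (W w)).
Proof.
move=> _ Y mY; rewrite setTI.
exact: (measurable_preimage_fin (F @^-1` Y)).
Qed.

Lemma fin_prob (E : set T) : measurable E -> (fine (P E))%:E = P E.
Proof. by move=> mE; rewrite fineK // fin_num_measure. Qed.

Lemma integral_cst_prob (E : set T) (r : R) : measurable E ->
  (\int[P]_(w in E) (cst r%:E) w)%E = (r * fine (P E))%:E.
Proof. by move=> mE; rewrite integral_cst // EFinM fin_prob. Qed.

Lemma integral_fin (F : V -> R) (E : set T) : measurable E ->
  (forall v, 0 <= F v) ->
  (\int[P]_(w in E) (F (W w))%:E =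
   (\sum_v F v * fine (P (E `&` W @^-1` [set v])))%:E)%E.
Proof.
move=> mE F0.
have mEW v : measurable (E `&` W @^-1` [set v]) by exact: measurableI.
have EE : E = \big[setU/set0]_(v <- index_enum V) (E `&` W @^-1` [set v]).
  rewrite -bigcup_seq; apply/seteqP; split => [w Ew|w [v _ []//]].
  by exists (W w) => //=; rewrite mem_index_enum.
rewrite {1}EE ge0_integral_bigsetU //; last 4 first.
- exact: index_enum_uniq.
- apply/trivIsetP => v v' _ _ /eqP vv'; apply/seteqP; split => //.
  by move=> w [[_ /= wv] [_ /= wv']]; apply: vv'; rewrite -wv.
- rewrite -EE; apply/measurable_realfun.measurable_EFinP; apply: measurable_funTS.
  exact: measurable_fun_fin.
- by move=> w _; rewrite lee_fin.
rewrite -sumEFin; apply: eq_bigr => v _.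
rewrite -integral_cst_prob //.
by apply: eq_integral => w; rewrite inE => -[_ /= ->].
Qed.

Lemma integrable_fin (F : V -> R) :
  P.-integrable setT (EFin \o (fun w => F (W w))).
Proof.
apply/integrableP; split; first exact/measurable_realfun.measurable_EFinP/measurable_fun_fin.
rewrite (_ : (\int[P]_(w in setT) _)%E =
    (\int[P]_(w in setT) (`|F (W w)|%R)%:E)%E); last first.
  by apply: eq_integral.
by rewrite (integral_fin (F := fun v => `|F v|)) // ltry.
Qed.

End FiniteValued.

Section MarkovStep.
Variables (R : realType) (d : measure_display) (T : measurableType d).
Variables (P : probability T R) (m : nat) (q : 'I_m -> R).
Variable idx : nat -> T -> 'I_m.
Hypothesis samp : sampling q P idx.
Variables (a b c k : nat).

(** The indices drawn before step [k] as a single element of a finite type: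
    every set of the past is then a union of finitely many atoms. *)
Definition history (w : T) : {ffun 'I_k -> 'I_m} := [ffun j => idx (val j) w].

Variables (X : T -> tensor R a b c) (phi : {ffun 'I_k -> 'I_m} -> tensor R a b c).
Hypothesis XE : forall w, X w = phi (history w).
Variable F : tensor R a b c -> 'I_m -> R.
Hypothesis F_ge0 : forall x i, 0 <= F x i.

Local Notation G := (sigma_tensor X).
Local Notation past := (past_events idx k).
Local Notation f := (fun w => F (X w) (idx k w)).

(** The mean of [F x] under one fresh draw; composed with the current state it
    is the conditional expectation. *)
Definition mean_step (x : tensor R a b c) : R := \sum_i q i * F x i.

Lemma past_history (Q : set {ffun 'I_k -> 'I_m}) : past (history @^-1` Q).
Proof.
rewrite [_ @^-1` _](_ : _ =
    \bigcup_(v in Q) \bigcap_(j in setT) idx (val j) @^-1` [set v j]).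
  apply: sigma_fin_bigcup => v _; apply: sigma_fin_bigcap => j _.
  by apply: sub_sigma_algebra; exists (val j), (v j); rewrite ltn_ord.
apply/seteqP; split => [w Qw|w [v Qv vw]].
  by exists (history w) => // j _ /=; rewrite ffunE.
rewrite /= (_ : history w = v) //.
by apply/ffunP => j; rewrite ffunE; exact: vw.
Qed.

Lemma past_measurable : past `<=` measurable.
Proof.
have [midx _ _] := samp.
apply: smallest_sub; first exact: sigma_algebra_measurable.
by move=> _ [j [i [_ ->]]].
Qed.

Lemma sigma_tensor_past : G `<=` past.
Proof.
apply: smallest_sub; first exact: smallest_sigma_algebra.
move=> _ [s [i [j [S [_ ->]]]]].
rewrite [_ @^-1` _](_ : _ = history @^-1` [set v | S (phi v s i j)]).
  exact: past_history.
by apply/seteqP; split => w /=; rewrite XE.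
Qed.

(** Equality of tensors is a finite conjunction of equalities of entries. *)
Lemma sigma_tensor_atom (x : tensor R a b c) : G (X @^-1` [set x]).
Proof.
rewrite [_ @^-1` _](_ : _ = \bigcap_(p in [set: 'I_c * ('I_a * 'I_b)])
   (fun w => X w p.1 p.2.1 p.2.2) @^-1` [set x p.1 p.2.1 p.2.2]).
  apply: sigma_fin_bigcap => -[s [i j]] _; apply: sub_sigma_algebra.
  by exists s, i, j, [set x s i j]; split => //; exact: measurable_set1.
apply/seteqP; split => w /= => [Xw p _ /=|xw]; first by rewrite Xw.
by apply/ffunP => s; apply/matrixP => i j; exact: (xw (s, (i, j))).
Qed.

(** Arbitrary sets of values are allowed since [X] takes finitely many values. *)
Lemma sigma_tensor_preimage (Q : set (tensor R a b c)) : G (X @^-1` Q).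
Proof.
rewrite [_ @^-1` _](_ : _ =
    \bigcup_(v in [set v | Q (phi v)]) X @^-1` [set phi v]).
  by apply: sigma_fin_bigcup => v _; exact: sigma_tensor_atom.
apply/seteqP; split => [w Qw|w [v Qv] /=]; last by move=> ->.
by exists (history w); rewrite /= -XE.
Qed.

(** Generators do not separate two outcomes with the same value of [X], and
    this property passes to complements and countable unions. Hence a function
    measurable for this sigma-algebra factors through [X]. *)
Lemma sigma_tensor_saturated (E : set T) : G E ->
  forall w w', X w = X w' -> E w -> E w'.
Proof.
move=> GE; suff : G `<=` [set E | forall w w', X w = X w' -> E w <-> E w'].
  by move=> /(_ _ GE) sat w w' /sat[].
apply: smallest_sub => [|_ [s [i [j [S [_ ->]]]]] w w' /= -> //].
split => [w w' _ //|E' sat w w' ww'|E' sat w w' ww'].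
  by split => -[_ nE]; split => // /(sat _ _ ww').
by split=> -[j _ Ej]; exists j => //; apply/(sat j _ _ ww').
Qed.

Let mhist v : measurable (history @^-1` [set v]).
Proof. by apply: past_measurable; exact: past_history. Qed.

Definition extended_history (w : T) := (history w, idx k w).

Let mext v : measurable (extended_history @^-1` [set v]).
Proof.
have [midx _ _] := samp.
rewrite [_ @^-1` _](_ : _ =
    history @^-1` [set v.1] `&` idx k @^-1` [set v.2]).
  exact: measurableI.
apply/seteqP; split => w; first by rewrite /= => <-.
by case: v => v1 v2 [] /= <- <-.
Qed.

(** Cut the event into atoms of the pair formed by the history and the new
    index; on each, the new index is independent of the past event. *)
Lemma integral_step (E : set T) : past E ->
  (\int[P]_(w in E) (f w)%:E = \int[P]_(w in E) (mean_step (X w))%:E)%E.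
Proof.
have [midx Pidx indep] := samp.
move=> pE; have mE := past_measurable pE.
have q0 i : 0 <= q i by rewrite -lee_fin -(Pidx k).
under eq_integral do rewrite XE.
rewrite (integral_fin P mext (F := fun v => F (phi v.1) v.2)) //.
under [RHS]eq_integral do rewrite XE.
rewrite (integral_fin P mhist (F := fun v => mean_step (phi v))) //; last first.
  by move=> v; apply: sumr_ge0 => i _; exact: mulr_ge0.
congr EFin; transitivity (\sum_v \sum_i F (phi v) i *
    fine (P (E `&` extended_history @^-1` [set (v, i)]))).
  by rewrite pair_bigA; apply: eq_bigr => -[].
apply: eq_bigr => v _; rewrite /mean_step mulr_suml; apply: eq_bigr => i _.
have -> : E `&` extended_history @^-1` [set (v, i)] =
    (E `&` history @^-1` [set v]) `&` idx k @^-1` [set i].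
  rewrite -setIA; congr (_ `&` _).
  by apply/seteqP; split => w /=; [move=> [-> ->]|move=> [<- <-]].
have pEv : past (E `&` history @^-1` [set v]) by apply: sigmaI => //; exact: past_history.
rewrite indep // Pidx fineM ?fin_num_measure //=; last exact: past_measurable.
by ring.
Qed.

Lemma is_condexp_step : is_condexp P G f (mean_step \o X).
Proof.
split.
- rewrite (_ : f = fun w => F (phi (extended_history w).1) (extended_history w).2).
    exact: (integrable_fin P mext (fun v => F (phi v.1) v.2)).
  by apply/funext => w; rewrite XE.
- rewrite (_ : _ \o X = fun w => mean_step (phi (history w))).
    exact: (integrable_fin P mhist (fun v => mean_step (phi v))).
  by apply/funext => w /=; rewrite XE.
- by move=> S _; exact: (sigma_tensor_preimage (mean_step @^-1` S)).
- by move=> E /sigma_tensor_past pE; rewrite -integral_step.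
Qed.

(** A version of the conditional expectation is constant on each fibre of [X],
    and both integrate to the same value there; so they agree on every fibre
    of positive probability, and the other fibres are finitely many null sets. *)
Lemma condexp_step_unique (g : T -> R) : is_condexp P G f g ->
  {ae P, forall w, g w = mean_step (X w)}.
Proof.
move=> [_ _ mg gf].
have mX x : measurable (X @^-1` [set x]).
  by apply: past_measurable; apply: sigma_tensor_past; exact: sigma_tensor_atom.
have gX w w' : X w = X w' -> g w = g w'.
  move=> ww'; apply/esym.
  exact: (sigma_tensor_saturated (mg [set g w] (measurable_set1 _)) ww').
have null w : g w != mean_step (X w) -> P (X @^-1` [set X w]) = 0%E.
  move=> gw; set E := X @^-1` [set X w].
  have : (\int[P]_(x in E) (g x)%:E = \int[P]_(x in E) (mean_step (X x))%:E)%E.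
    rewrite gf; last exact: sigma_tensor_atom.
    by apply: integral_step; apply: sigma_tensor_past; exact: sigma_tensor_atom.
  rewrite (eq_integral (cst (g w)%:E)); last first.
    by move=> x; rewrite inE => /gX ->.
  rewrite [RHS](eq_integral (cst (mean_step (X w))%:E)); last first.
    by move=> x; rewrite inE => /= ->.
  have mE : measurable E by exact: mX.
  rewrite !integral_cst_prob // => -[] /eqP.
  rewrite -subr_eq0 -mulrBl mulf_eq0 subr_eq0 (negbTE gw) /= => /eqP PE0.
  by rewrite -fin_prob // PE0.
apply: (@negligibleS _ _ _ _ (\big[setU/set0]_(v <- index_enum _ |
    P (X @^-1` [set phi v]) == 0%E) X @^-1` [set phi v])); last first.
  apply: big_ind => [|E E' E0 E'0|v /eqP v0]; first exact: negligible_set0.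
    exact: negligibleU.
  exact/negligibleP.
move=> w /= /eqP gw; rewrite -bigcup_seq_cond; exists (history w) => /=.
  by rewrite mem_index_enum /= -XE null.
exact: XE.
Qed.

End MarkovStep.

(** The iterate depends only on the indices drawn so far, even across
    different sample spaces; this expresses it as a function of the history. *)
Lemma trkl_eq (R : realType) (m l p n : nat)
    (A : tensor R m l n.+1) (B : tensor R m p n.+1) (Ile : {set 'I_m})
    (t : 'I_m -> R) (X0 : tensor R l p n.+1) (T T' : Type)
    (idx : nat -> T -> 'I_m) (idx' : nat -> T' -> 'I_m) k w w' :
  (forall j, (j < k)%N -> idx j w = idx' j w') ->
  trkl A B Ile t X0 idx k w = trkl A B Ile t X0 idx' k w'.
Proof.
elim: k => [//|k IH] idxE; rewrite [LHS]/= [RHS]/= (idxE k (ltnSn k)).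
by rewrite (IH (fun j jk => idxE j (leqW jk))).
Qed.

(** * Linear convergence in expectation *)

Theorem theorem4p5 (R : realType) (m l p n : nat)
  (A : tensor R m.+1 l.+1 n.+1) (B : tensor R m.+1 p.+1 n.+1)
  (Ile Ieq : {set 'I_m.+1}) (t : 'I_m.+1 -> R) (X0 : tensor R l.+1 p.+1 n.+1)
  (d : measure_display) (T : measurableType d) (P : probability T R)
  (idx : nat -> T -> 'I_m.+1) :
  (forall i, row_slice i A != 0) ->
  (Ile :&: Ieq)%SET = finset.set0 ->
  (Ile :|: Ieq)%SET = finset.setT ->
  feasible A B Ile Ieq !=set0 ->
  (forall i, 0 < t i <
     2 * fnorm (row_slice i A) ^+ 2 / max_slice_norm2 (row_slice i A)) ->
  sampling (fun i => fnorm (row_slice i A) ^+ 2 / fnorm A ^+ 2) P idx ->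
  let Omega := feasible A B Ile Ieq in
  let X := trkl A B Ile t X0 idx in
  exists gamma : R,
    [/\ 0 < gamma,
        least (hoffman_bounds A B Ile Ieq) gamma,
        trkl_rate A t gamma < 1 &
        forall k : nat,
          let f := fun w => tdist (X k.+1 w) Omega ^+ 2 in
          let G := sigma_tensor (X k) in
          (exists g, is_condexp P G f g) /\
          (forall g, is_condexp P G f g ->
             {ae P, forall w,
                g w <= trkl_rate A t gamma * tdist (X k w) Omega ^+ 2})].
Proof.
move=> A0 IleIeq0 IleIeqT feas tb samp Om X.
pose S := @hoffman_bounds R m.+1 l.+1 p.+1 n A B Ile Ieq.
have leastS : least S (inf S).
  exact: (least_hoffman_bound A0 IleIeq0 IleIeqT feas tb).
exists (inf S); split => //.
- exact: (hoffman_bounds_gt0 A0 IleIeqT feas tb leastS.1).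
- apply: (trkl_rate_lt1 A0 tb).
  exact: (hoffman_bounds_gt0 A0 IleIeqT feas tb leastS.1).
move=> k /=.
(* The algorithm is run on the space of histories itself; the default index is
   never consulted before step [k]. *)
pose idxh j (h : {ffun 'I_k -> 'I_m.+1}) : 'I_m.+1 :=
  if insub j is Some j' then h j' else ord0.
have XE w : X k w = trkl A B Ile t X0 idxh k (history idx k w).
  apply: trkl_eq => j jk; rewrite /idxh insubT /= ffunE //.
pose F x i := tdist (trkl_step A B Ile t i x) Om ^+ 2.
have F0 x i : 0 <= F x i by exact: sqr_ge0.
split; first by exists (mean_step (fun i => fnorm (row_slice i A) ^+ 2 / fnorm A ^+ 2) F \o X k);
  exact: (is_condexp_step samp XE F0).
move=> g /(condexp_step_unique samp XE F0); apply: filterS => w ->.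
exact: (expected_step A0 IleIeqT feas tb (X k w) leastS.1).
Qed.
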